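(* Let $\Gamma$ be a finite connected graph. Then every purely loxodromic subgroup of the right-angled Artin group $A(\Gamma)$ is free.
   Context: Graphs are simplicial. $A(\Gamma)=\langle V(\Gamma)\mid [a,b]=1 \text{ for each } \{a,b\}\in E(\Gamma)\rangle$. The extension graph $\Gamma^e$ has vertex set $\{v^g : v\in V(\Gamma), g\in A(\Gamma)\}$, $v^g=g^{-1}vg$, with two distinct vertices adjacent iff they commute in $A(\Gamma)$; it carries the graph metric $d$, and $A(\Gamma)$ acts by conjugation $v^h\mapsto v^{hg}$. An element $g\in A(\Gamma)$ is loxodromic if $\lim_{n\to\infty}\frac1n d(x,x^{g^n})>0$ for $x\in\Gamma^e$. A subgroup $G\le A(\Gamma)$ is purely loxodromic if every $1\ne g\in G$ is loxodromic in $A(\Gamma)$. The subgroup is not assumed to be finitely generated. *)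

(* Defs.v *)
From HB Require Import structures.
From mathcomp Require Import all_boot all_order all_algebra.
From mathcomp Require Import all_classical all_reals all_analysis.
Import Order.TTheory GRing.Theory Num.Theory.
Import numFieldNormedType.Exports.

Set Implicit Arguments.
Unset Strict Implicit.
Unset Printing Implicit Defensive.

Local Open Scope classical_set_scope.
Local Open Scope quotient_scope.

(** The letter [(s, false)] stands for the generator [s], and [(s, true)] for
    its formal inverse. *)
Definition word (S : Type) := seq (S * bool).

Definition word_inv (S : Type) (w : word S) : word S :=
  rev [seq (l.1, ~~ l.2) | l <- w].

(** Equality of words in the group with generators [S] and relators [rels]. *)
Inductive word_eq (S : Type) (rels : set (word S)) : word S -> word S -> Prop :=
| word_eq_refl w : word_eq rels w w
| word_eq_sym w1 w2 : word_eq rels w1 w2 -> word_eq rels w2 w1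
| word_eq_trans w1 w2 w3 :
    word_eq rels w1 w2 -> word_eq rels w2 w3 -> word_eq rels w1 w3
| word_eq_cancel u v s b :
    word_eq rels (u ++ [:: (s, b); (s, ~~ b)] ++ v) (u ++ v)
| word_eq_rel u v r : rels r -> word_eq rels (u ++ r ++ v) (u ++ v).

Section WordTheory.
Variables (S : Type) (rels : set (word S)).
Implicit Types u v w : word S.

Lemma word_invK : involutive (@word_inv S).
Proof.
move=> w; rewrite /word_inv map_rev revK -map_comp -[RHS]map_id.
by apply: eq_map => -[s b] /=; rewrite negbK.
Qed.

Lemma word_inv_cat u v : word_inv (u ++ v) = word_inv v ++ word_inv u.
Proof. by rewrite /word_inv map_cat rev_cat. Qed.

Lemma word_eq_catl u v w : word_eq rels v w -> word_eq rels (u ++ v) (u ++ w).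
Proof.
elim=> {v w} [w|v w _|v w x _ vw _ wx|v w s b|v w r rr].
- exact: word_eq_refl.
- exact: word_eq_sym.
- exact: word_eq_trans vw wx.
- by rewrite !(catA u); apply: word_eq_cancel.
- by rewrite !(catA u); apply: word_eq_rel.
Qed.

Lemma word_eq_catr u v w : word_eq rels v w -> word_eq rels (v ++ u) (w ++ u).
Proof.
elim=> {v w} [w|v w _|v w x _ vw _ wx|v w s b|v w r rr].
- exact: word_eq_refl.
- exact: word_eq_sym.
- exact: word_eq_trans vw wx.
- by rewrite -!catA; apply: word_eq_cancel.
- by rewrite -!catA; apply: word_eq_rel.
Qed.

Lemma word_eq_cat u1 u2 v1 v2 : word_eq rels u1 u2 -> word_eq rels v1 v2 ->
  word_eq rels (u1 ++ v1) (u2 ++ v2).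
Proof.
move=> u12 v12; apply: word_eq_trans (word_eq_catr v1 u12) _.
exact: word_eq_catl.
Qed.

Lemma word_eq_invr w : word_eq rels (w ++ word_inv w) [::].
Proof.
elim: w => [|[s b] w IH]; first exact: word_eq_refl.
have -> : (s, b) :: w = [:: (s, b)] ++ w by [].
rewrite word_inv_cat -catA (catA w).
apply: word_eq_trans (word_eq_catl _ (word_eq_catr _ IH)) _.
exact: (word_eq_cancel rels [::] [::]).
Qed.

Lemma word_eq_invl w : word_eq rels (word_inv w ++ w) [::].
Proof. by have := word_eq_invr (word_inv w); rewrite word_invK. Qed.

Lemma word_eq_inv v w :
  word_eq rels v w -> word_eq rels (word_inv v) (word_inv w).
Proof.
move=> vw; apply: (@word_eq_trans _ _ _ (word_inv v ++ w ++ word_inv w)).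
  rewrite -[X in word_eq _ X _]cats0; apply: word_eq_catl.
  exact/word_eq_sym/word_eq_invr.
rewrite catA -[X in word_eq _ _ X]cat0s; apply: word_eq_catr.
apply: word_eq_trans (word_eq_invl v).
exact/word_eq_catl/word_eq_sym.
Qed.

End WordTheory.

Section PresentedGroup.
Variables (S : choiceType) (rels : set (word S)).

Definition word_eqb (w1 w2 : word S) : bool := `[< word_eq rels w1 w2 >].

Fact word_eqb_equiv : equiv_class_of word_eqb.
Proof.
split=> [w|w1 w2|w2 w1 w3].
- exact/asboolP/word_eq_refl.
- by apply/asboolP/asboolP; apply: word_eq_sym.
- by move=> /asboolP h1 /asboolP h2; apply/asboolP; apply: word_eq_trans h2.
Qed.

Canonical word_eqb_equiv_rel := EquivRelPack word_eqb_equiv.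

(** The group < S | rels >. *)
Definition presented := {eq_quot word_eqb_equiv_rel}.

HB.instance Definition _ := Choice.on presented.
HB.instance Definition _ := Quotient.on presented.

Lemma presented_eq (w1 w2 : word S) :
  \pi_presented w1 = \pi_presented w2 <-> word_eq rels w1 w2.
Proof. by split=> [/eqmodP/asboolP//|h]; apply/eqmodP/asboolP. Qed.

Lemma word_eq_repr (w : word S) : word_eq rels (repr (\pi_presented w)) w.
Proof. by apply/presented_eq; rewrite reprK. Qed.

Definition presented_one : presented := \pi_presented [::].
Definition presented_mul (x y : presented) : presented :=
  \pi_presented (repr x ++ repr y).
Definition presented_inv (x : presented) : presented :=
  \pi_presented (word_inv (repr x)).

Fact presented_mulA : associative presented_mul.
Proof.
move=> x y z; apply/presented_eq.
apply: word_eq_trans (word_eq_catl _ (word_eq_repr _)) _; rewrite catA.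
exact/word_eq_catr/word_eq_sym/word_eq_repr.
Qed.

Fact presented_mul1 : left_id presented_one presented_mul.
Proof.
move=> x; rewrite -[RHS]reprK; apply/presented_eq.
exact: (word_eq_catr _ (word_eq_repr [::])).
Qed.

Fact presented_mulr1 : right_id presented_one presented_mul.
Proof.
move=> x; rewrite -[RHS]reprK; apply/presented_eq.
by have := word_eq_catl (repr x) (word_eq_repr [::]); rewrite cats0.
Qed.

Fact presented_mulV : left_inverse presented_one presented_inv presented_mul.
Proof.
move=> x; apply/presented_eq.
apply: word_eq_trans (word_eq_catr _ (word_eq_repr _)) _.
exact: word_eq_invl.
Qed.

Fact presented_mulrV : right_inverse presented_one presented_inv presented_mul.
Proof.
move=> x; apply/presented_eq.
apply: word_eq_trans (word_eq_catl _ (word_eq_repr _)) _.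
exact: word_eq_invr.
Qed.

HB.instance Definition _ := isGroup.Build presented presented_mulA
  presented_mul1 presented_mulr1 presented_mulV presented_mulrV.

Definition presented_gen (s : S) : presented := \pi_presented [:: (s, false)].

Lemma presented_piM (u v : word S) :
  \pi_presented (u ++ v) = (\pi_presented u * \pi_presented v)%g.
Proof.
by apply/presented_eq/word_eq_sym/word_eq_cat; apply: word_eq_repr.
Qed.

Lemma presented_piV (u : word S) :
  \pi_presented (word_inv u) = (\pi_presented u)^-1%g.
Proof. exact/presented_eq/word_eq_sym/word_eq_inv/word_eq_repr. Qed.

Lemma presented_pi1 : \pi_presented [::] = 1%g.
Proof. by []. Qed.

End PresentedGroup.

Definition free_group (X : choiceType) : groupType :=
  presented (set0 : set (word X)).

Local Open Scope group_scope.

Definition is_free (A : groupType) (G : set A) : Prop :=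
  exists (X : choiceType) (phi : {multiplicative free_group X -> A}),
    injective phi /\ range phi = G.

Definition walk_length (T : Type) (e : rel T) (x y : T) (n : nat) : Prop :=
  exists p : seq T, [/\ path e x p, last x p = y & size p = n].

(** The graph metric. The value is a default [0] if no walk joins [x] to [y];
    for the extension graph of a connected graph this never happens, see
    [ext_graph_connected]. *)
Definition graph_dist (T : Type) (e : rel T) (x y : T) : nat :=
  if pselect (exists n, `[< walk_length e x y n >]) is left exn
  then ex_minn exn else 0.

Definition raag_rels (V : choiceType) (e : rel V) : set (word V) :=
  [set w | exists a b, e a b /\
     w = [:: (a, true); (b, true); (a, false); (b, false)]].

Definition raag (V : choiceType) (e : rel V) : groupType :=
  presented (raag_rels e).

Definition raag_gen (V : choiceType) (e : rel V) (v : V) : raag e :=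
  presented_gen (raag_rels e) v.

Section ExtensionGraph.
Variables (V : choiceType) (e : rel V).

Definition is_ext_vertex (x : raag e) : bool :=
  `[< exists v g, x = raag_gen e v ^ g >].

Definition ext_vertex := {x : raag e | is_ext_vertex x}.

Definition ext_adj : rel ext_vertex := fun x y =>
  (x != y) && (val x * val y == val y * val x).

Fact ext_act_subproof (x : ext_vertex) (g : raag e) : is_ext_vertex (val x ^ g).
Proof.
have /asboolP[v [h xE]] := valP x.
by apply/asboolP; exists v, (h * g); rewrite xE conjgM.
Qed.

Definition ext_act (x : ext_vertex) (g : raag e) : ext_vertex :=
  Sub (val x ^ g) (ext_act_subproof x g).

End ExtensionGraph.

Section ExtensionGraphConnected.
Variables (V : finType) (e : rel V).
Hypothesis e_conn : forall x y, connect e x y.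

Let linked (x y : ext_vertex e) := exists n, walk_length (@ext_adj V e) x y n.

Let linked_refl x : linked x x.
Proof. by exists 0, [::]. Qed.

Let linked_trans x y z : linked x y -> linked y z -> linked x z.
Proof.
move=> [_ [p [xp <- _]]] [_ [q [yq <- _]]]; exists (size (p ++ q)), (p ++ q).
by split=> //; [rewrite cat_path xp | rewrite last_cat].
Qed.

Lemma raag_gen_commute a b : e a b -> commute (raag_gen e a) (raag_gen e b).
Proof.
move=> eab; suff : (raag_gen e a)^-1 * (raag_gen e b)^-1 * raag_gen e a *
    raag_gen e b = 1.
  by move=> h; apply/commgP; rewrite commgEl conjgE !mulgA h.
have : \pi_(raag e) (word_inv [:: (a, false)] ++ word_inv [:: (b, false)] ++
    [:: (a, false)] ++ [:: (b, false)]) = 1.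
  apply/presented_eq; apply: (@word_eq_rel _ _ [::] [::]
    [:: (a, true); (b, true); (a, false); (b, false)]).
  by exists a, b.
by rewrite !presented_piM !presented_piV !mulgA.
Qed.

Let vtx (v : V) (g : raag e) : ext_vertex e :=
  Sub (raag_gen e v ^ g)
      (introT (asboolP _) (ex_intro _ v (ex_intro _ g erefl))).

Let vtx_linked a b g : linked (vtx a g) (vtx b g).
Proof.
have /connectP[p ap ->] := e_conn a b.
elim: p a ap => [|c p IH] a /=; first by move=> _; apply: linked_refl.
move=> /andP[eac cp]; apply: linked_trans (IH _ cp).
have [->|ne] := eqVneq (vtx a g) (vtx c g); first exact: linked_refl.
exists 1%N, [:: vtx c g]; split=> //=; rewrite andbT /ext_adj ne /=.
by apply/eqP; rewrite -!conjMg (raag_gen_commute eac).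
Qed.

Let vtx_linkedM a (w : word V) (g : raag e) :
  linked (vtx a (\pi_(raag e) w * g)) (vtx a g).
Proof.
elim: w g => [|[s b] w IH] g.
  by rewrite presented_pi1 mul1g; apply: linked_refl.
apply: linked_trans (IH g).
rewrite -(cat1s (s, b)) presented_piM -mulgA.
move: (_ * g) => k.
apply: linked_trans (vtx_linked a s _) _.
apply: linked_trans (vtx_linked s a k).
have -> : vtx s (\pi_(raag e) [:: (s, b)] * k) = vtx s k; last exact: linked_refl.
apply: val_inj; rewrite /= conjgM; congr (_ ^ _).
apply/conjg_fixP/commgP; case: b => //.
rewrite -[[:: _]]/(word_inv [:: (s, false)]) presented_piV.
exact/commuteV.
Qed.

Lemma ext_graph_connected (x y : ext_vertex e) :
  exists n, walk_length (@ext_adj V e) x y n.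
Proof.
have vtxE (z : ext_vertex e) : exists v g, z = vtx v g.
  have /asboolP[v [g zE]] := valP z.
  by exists v, g; apply: val_inj.
have [[a [g ->]] [b [h ->]]] := (vtxE x, vtxE y).
apply: linked_trans (vtx_linked a b h).
by have := vtx_linkedM a (repr (g / h)) h; rewrite reprK mulgVK.
Qed.

End ExtensionGraphConnected.

Definition loxodromic (R : realType) (V : choiceType) (e : rel V) (g : raag e) :
    Prop :=
  forall x : ext_vertex e, exists2 l : R, (0 < l)%R &
    (fun n : nat => (n%:R^-1 *
       (graph_dist (@ext_adj V e) x (ext_act x (g ^+ n)))%:R : R)%R) @ \oo --> l.

Definition purely_loxodromic (R : realType) (V : choiceType) (e : rel V)
    (G : set (raag e)) : Prop :=
  forall g, G g -> g <> 1 -> loxodromic R g.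

(* Main.v *)
Require Import Defs.
From HB Require Import structures.
From mathcomp Require Import all_boot all_order all_algebra.
From mathcomp Require Import all_classical all_reals all_analysis.
Import Order.TTheory numFieldNormedType.Exports.

(** Write A for the Artin group and call its standard generators vertices. An
    element that commutes with a conjugate of a vertex fixes a point of the
    extension graph, so it is not loxodromic. Hence the only element of a purely
    loxodromic subgroup G that commutes with a conjugate of a vertex is 1
    ([purely_loxodromic_centralizer_free]), and the theorem is that every
    subgroup with this property is free.

    Fix a vertex v. A is the HNN extension of B, the Artin group of the graph
    without v, with stable letter v, and the associated subgroup H consists of
    the elements of B that commute with v. On the Bass-Serre tree of this
    extension, G acts with trivial edge stabilizers, because these lie in
    conjugates of H, and the vertex stabilizers are subgroups of conjugates of
    B with the same property, hence free by induction on the number of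
    vertices. So G should be a free product of free groups.

    The proof uses neither the tree nor normal forms in A. They are replaced by
    a principle that can be read off the presentation: a labelling of the edges
    of the Cayley graph of A by elements of a group F, for which the labels
    around each relator multiply to 1, has a potential Phi : A -> F
    ([presented_potential]). If the labelling is invariant under left
    translation by G, then Phi restricts to a morphism G -> F
    ([potential_left]). This gives the morphisms out of G, which is known only
    as a subgroup.

    The induction proves that G is a retract of a free group, in the sense of
    [free_retract]: there are morphisms psi from G to a free group and theta
    back to A with theta (psi g) = g on G. This formulation needs no maximal
    tree in the quotient graph: the free group may have too many generators.
    In the inductive step ([free_retract_step]) the target F is free on the
    union of the bases obtained for all vertex groups and of one further
    generator for each element of A, more than there are edges in the quotient.
    The edges of the Cayley graph that belong to vertices other than v get their
    labels from the vertex groups. On an H-orbit of edges that belong to v one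
    label may be chosen freely, and the others are then forced by the squares
    spanned by v and its neighbours; no consistency condition remains since H
    acts freely on the cosets of G.

    Finally a retract of a free group is isomorphic to a subgroup of it, and is
    free by the Nielsen-Schreier theorem ([subgroup_free]), for which the same
    principle produces the inverse of the map from the free group on Schreier's
    generators. *)

Set Implicit Arguments.
Unset Strict Implicit.
Unset Printing Implicit Defensive.

Local Open Scope classical_set_scope.
Local Open Scope quotient_scope.
Local Open Scope group_scope.

(** * Potentials on Cayley graphs *)

Section Potential.
Variables (S : choiceType) (rels : set (word S)).
Local Notation P := (presented rels).
Local Notation gen := (presented_gen rels).

Lemma pi_letter (s : S) b : \pi_P [:: (s, b)] = if b then (gen s)^-1 else gen s.
Proof. by case: b => //; rewrite -presented_piV. Qed.

(** The Cayley graph is connected. A step of the induction is an equivalence, as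
    a path may follow an edge in either direction. *)
Lemma presented_ind (Q : P -> Prop) : Q 1 ->
  (forall a s, Q a <-> Q (a * gen s)) -> forall a, Q a.
Proof.
move=> Q1 Qs a; rewrite -[a]reprK; elim/last_ind: (repr a) => // w [s b] IH.
rewrite -cats1 presented_piM pi_letter; case: b; last exact: (Qs _ _).1.
by apply: (Qs _ s).2; rewrite mulgVK.
Qed.

Variables (F : groupType) (C : S -> P -> F).

(** [C s a] is read as the label of the edge from [a] to [a * gen s]; an edge
    followed backwards contributes the inverse of its label. *)
Definition transport (p : P * F) (l : S * bool) : P * F :=
  if l.2 then (p.1 / gen l.1, p.2 / C l.1 (p.1 / gen l.1))
  else (p.1 * gen l.1, p.2 * C l.1 p.1).

Lemma transport_end p w : (foldl transport p w).1 = p.1 * \pi_P w.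
Proof.
elim: w p => [|[s b] w IH] p /=; first by rewrite presented_pi1 mulg1.
rewrite IH -(cat1s _ w) presented_piM pi_letter mulgA.
by rewrite /transport; case: b.
Qed.

(** The loops of the Cayley graph are generated by cancellations and by
    translates of relators, so a labelling that is trivial on those is the
    increment of a function. *)
Lemma presented_potential :
  (forall r, rels r -> forall p, foldl transport p r = p) ->
  exists Phi : P -> F, Phi 1 = 1 /\
    forall s a, Phi (a * gen s) = Phi a * C s a.
Proof.
move=> closedC.
have inv w1 w2 : word_eq rels w1 w2 ->
    forall p, foldl transport p w1 = foldl transport p w2.
  elim=> {w1 w2} [//|w1 w2 _ IH|w1 w2 w3 _ IH1 _ IH2|u w s b|u w r rr] p.
  - by rewrite IH.
  - by rewrite IH1.
  - rewrite !foldl_cat; congr foldl; move: (foldl _ p u) => [x f] /=.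
    by rewrite /transport; case: b => /=; rewrite ?(mulgK, mulgVK).
  - by rewrite !foldl_cat (closedC _ rr).
exists (fun a => (foldl transport (1, 1) (repr a)).2); split.
  by rewrite (inv _ _ (word_eq_repr rels [::])).
move=> s a; set w := repr (a * gen s).
have -> : foldl transport (1, 1) w =
          foldl transport (1, 1) (repr a ++ [:: (s, false)]).
  by apply: inv; apply/presented_eq; rewrite presented_piM !reprK.
rewrite foldl_cat /=; congr (_ * C s _).
by rewrite transport_end mul1g reprK.
Qed.

End Potential.

(** Both sides, as functions of [a], have the same increments and the same value
    at [1]. For [g] in a subgroup under which the labelling is invariant, this
    makes the restriction of the potential to that subgroup a morphism. *)
Lemma potential_left (S : choiceType) (rels : set (word S)) (F : groupType)
    (C : S -> presented rels -> F) (Phi : presented rels -> F) g :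
  Phi 1 = 1 ->
  (forall s a, Phi (a * presented_gen rels s) = Phi a * C s a) ->
  (forall s a, C s (g * a) = C s a) ->
  forall a, Phi (g * a) = Phi g * Phi a.
Proof.
move=> Phi1 PhiS Cg; apply: presented_ind => [|a s].
  by rewrite Phi1 !mulg1.
by rewrite mulgA !PhiS Cg mulgA; split=> [-> //|/mulIg].
Qed.

(** A morphism is a potential of a labelling that depends on the generator
    only. *)
Lemma presented_hom (S : choiceType) (rels : set (word S)) (K : groupType)
    (k : S -> K) :
  (forall r, rels r -> forall p,
     foldl (transport (fun s (_ : presented rels) => k s)) p r = p) ->
  exists f : UMagmaMorphism.type (presented rels) K,
    forall s, f (presented_gen rels s) = k s.
Proof.
move=> /presented_potential[f [f1 fS]].
have fM : {morph f : x y / x * y}.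
  by move=> x y; apply: (potential_left f1 fS).
pose fM' := isMultiplicative.Build _ _ f fM.
pose f1' := Multiplicative_isUMagmaMorphism.Build _ _ f f1.
pose F : UMagmaMorphism.type (presented rels) K := HB.pack f fM' f1'.
by exists F => s; rewrite -[X in F X]mul1g /= fS f1 mul1g.
Qed.

Lemma free_hom (X : choiceType) (K : groupType) (k : X -> K) :
  exists f : UMagmaMorphism.type (free_group X) K,
    forall x, f (presented_gen _ x) = k x.
Proof. exact: presented_hom. Qed.

(** * Right-angled Artin groups *)

Section Raag.
Variables (V : finType) (e : rel V).
Local Notation gen := (raag_gen e).

(** A relator loop runs around a square with sides [s] and [t]. *)
Lemma raag_potential (F : groupType) (C : V -> raag e -> F) :
  (forall s t a, e s t ->
     C s a * C t (a * gen s) = C t a * C s (a * gen t)) ->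
  forall r, raag_rels e r -> forall p, foldl (transport C) p r = p.
Proof.
move=> square _ [s [t [est ->]]] [x f] /=; rewrite /transport /=.
(* The loop starts at the corner opposite to [c]. *)
have [c ->] : exists c, x = c * gen t * gen s.
  by exists (x / gen s / gen t); rewrite !mulgVK.
rewrite !mulgK.
congr pair; first by rewrite -mulgA (raag_gen_commute est) mulgA.
by rewrite -mulgA square // mulgA !mulgVK.
Qed.

Lemma raag_hom (K : groupType) (k : V -> K) :
  (forall s t, e s t -> commute (k s) (k t)) ->
  exists f : UMagmaMorphism.type (raag e) K, forall s, f (gen s) = k s.
Proof.
by move=> kC; apply/presented_hom/raag_potential => s t _ /kC.
Qed.

End Raag.

Definition del_rel (V : eqType) (e : rel V) (v : V) : rel {x : V | x != v} :=
  fun x y => e (val x) (val y).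
Arguments del_rel [V] e v.

(** The subgroup generated by the vertices other than [v] is the Artin group of
    the graph without [v]: sending [v] to [1] gives a left inverse. *)
Lemma raag_sub (V : finType) (e : rel V) (v : V) :
  exists f : UMagmaMorphism.type (raag (del_rel e v)) (raag e),
    injective f /\ forall w, f (raag_gen _ w) = raag_gen e (val w).
Proof.
set eW := del_rel e v.
have [f fE] : exists f : UMagmaMorphism.type (raag eW) (raag e),
    forall w, f (raag_gen _ w) = raag_gen e (val w).
  by apply: raag_hom => s t st; apply: raag_gen_commute; exact: st.
have [g gE] : exists g : UMagmaMorphism.type (raag e) (raag eW),
    forall x, g (raag_gen _ x) = if insub x is Some w then raag_gen eW w else 1.
  apply: raag_hom => s t est; case: insubP => [s' _ sE|_]; last first.
    exact/commute_sym/commute1.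
  case: insubP => [t' _ tE|_]; last exact/commute1.
  by apply: (@raag_gen_commute _ eW); rewrite /eW /del_rel sE tE.
exists f; split=> //; apply: (can_inj (g := g)).
apply: presented_ind => [|a s]; first by rewrite !gmulf1.
have -> : g (f (a * presented_gen _ s)) = g (f a) * presented_gen _ s.
  by rewrite !gmulfM fE gE valK.
by split=> [-> //|/mulIg].
Qed.

(** * Cosets of a subgroup *)

Section Cosets.
Variables (A : groupType) (G : set A).

Definition subgroup := G 1 /\ forall x y, G x -> G y -> G (x / y).

Definition coset_eq (x y : A) := G (x / y).
Local Notation "x ~ y" := (coset_eq x y) (at level 70).

Hypothesis Gs : subgroup.

Lemma subgV x : G x -> G x^-1.
Proof. by move=> Gx; rewrite -div1g; apply: Gs.2 => //; apply: Gs.1. Qed.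

Lemma subgM x y : G x -> G y -> G (x * y).
Proof. by move=> Gx Gy; rewrite -[y]invgK; apply: Gs.2 => //; apply: subgV. Qed.

Lemma coset_refl x : x ~ x.
Proof. by rewrite /coset_eq divgg; apply: Gs.1. Qed.

Lemma coset_sym x y : x ~ y -> y ~ x.
Proof. by move=> /subgV; rewrite invgF. Qed.

Lemma coset_trans y x z : x ~ y -> y ~ z -> x ~ z.
Proof. by move=> xy yz; rewrite /coset_eq -(divgKA y); apply: subgM. Qed.

Lemma coset_mulr z x y : x ~ y -> x * z ~ y * z.
Proof. by rewrite /coset_eq mulgKA. Qed.

Lemma coset_mull g x : G g -> g * x ~ x.
Proof. by rewrite /coset_eq mulgK. Qed.

End Cosets.

(** * Schreier transversals and subgroups of free groups *)

Section Schreier.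
Variables (S : choiceType) (rels : set (word S)).
Local Notation P := (presented rels).
Local Notation gen := (presented_gen rels).
Variable G : set P.
Hypothesis Gs : subgroup G.
Local Notation "x ~ y" := (coset_eq G x y) (at level 70).

Definition reach n (a : P) := exists2 w : word S, size w <= n & \pi_P w ~ a.

(** [p] splits a path to the coset of [a] into its last edge and an initial part
    that leads to the coset of [p.1] in at most [n] steps. *)
Definition stem n a (p : P * P) :=
  [/\ reach n p.1, exists l, p.2 = \pi_P [:: l] & p.1 * p.2 ~ a].

(** A representative of the coset of [a], for [a] reachable in [n] steps, that
    extends the representative of a coset closer to the base point by one
    letter. The letter is picked from a set that depends on the coset only, so
    all elements of the coset get the same representative. *)
Fixpoint schreier n a : P :=
  if n is m.+1 then
    if `[< reach m a >] then schreier m a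
    else let p := xget (1, 1) (stem m a) in schreier m p.1 * p.2
  else 1.

Lemma reach_coset n a b : a ~ b -> reach n a -> reach n b.
Proof. by move=> ab [w wn wa]; exists w => //; apply: coset_trans ab. Qed.

Lemma reach_ex a : exists n, `[< reach n a >].
Proof.
exists (size (repr a)); apply/asboolP; exists (repr a) => //.
by rewrite reprK; apply: coset_refl.
Qed.

Definition height a := ex_minn (reach_ex a).

Lemma heightP a : reach (height a) a.
Proof. by rewrite /height; case: ex_minnP => n /asboolP. Qed.

Lemma height_min n a : reach n a -> height a <= n.
Proof. by rewrite /height; case: ex_minnP => m _ min /asboolP/min. Qed.

Lemma height_coset a b : a ~ b -> height a = height b.
Proof.
move=> ab; apply/eqP; rewrite eqn_leq; apply/andP; split; apply: height_min.
  by apply: reach_coset (heightP b); apply: coset_sym.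
exact: reach_coset (heightP a).
Qed.

Lemma reachP n a : reach n a <-> height a <= n.
Proof.
split=> [|le]; first exact: height_min.
by have [w wle wa] := heightP a; exists w => //; apply: leq_trans le.
Qed.

Lemma stemP n a : reach n.+1 a -> ~ reach n a ->
  stem n a (xget (1, 1) (stem n a)).
Proof.
move=> [w + wa] na; case/lastP: w wa => [|w l] wa.
  by case: na; exists [::].
rewrite size_rcons ltnS => wn; apply: (@xgetPex _ _ _ _).
exists (\pi_P w, \pi_P [:: l]).
split; [|by exists l|by rewrite /= -presented_piM cats1].
by exists w => //; apply: coset_refl.
Qed.

Lemma schreier_coset n a b : a ~ b -> schreier n a = schreier n b.
Proof.
elim: n a b => //= n IH a b ab.
have -> : stem n a = stem n b.
  apply/predeqP => p; split=> -[? ? pa]; split=> //;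
    apply: coset_trans pa _ => //.
  exact: coset_sym.
have -> : `[< reach n a >] = `[< reach n b >].
  by apply/asbool_equiv_eq; rewrite !reachP (height_coset ab).
by rewrite (IH a b).
Qed.

Lemma schreier_rep n a : reach n a -> schreier n a ~ a.
Proof.
elim: n a => [|n IH] a /=.
  by move=> [w]; rewrite leqn0 size_eq0 => /eqP->.
move=> rna; case: asboolP => [/IH //|na].
have [/IH h _ pa] := stemP rna na.
by apply: coset_trans pa => //; apply: coset_mulr.
Qed.

Lemma schreier_height n a :
  height a <= n -> schreier n a = schreier (height a) a.
Proof.
elim: n => [|n IH]; first by rewrite leqn0 => /eqP->.
rewrite leq_eqVlt => /predU1P[-> //|]; rewrite ltnS => le /=.
by case: asboolP => [_|[]]; [exact: IH | exact/reachP].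
Qed.

Lemma schreier_stem a : schreier (height a) a = 1 \/
  exists b l, height b < height a /\
    schreier (height a) a = schreier (height b) b * \pi_P [:: l].
Proof.
case hE: (height a) => [|n]; first by left.
right; have na : ~ reach n a by rewrite reachP hE ltnn.
have rna : reach n.+1 a by rewrite reachP hE.
have [rp [l lE] _] := stemP rna na; rewrite /=.
set p := xget _ _ in rp lE *.
exists p.1, l; move/reachP: (rp) => hp; split=> //.
by case: asboolP => // _; rewrite lE schreier_height.
Qed.

(** The last property is induction along the Schreier tree: its edges are the
    steps that lead from a representative to a representative. *)
Lemma schreier_transversal : exists r : P -> P,
  [/\ forall a, r a ~ a,
      forall a b, a ~ b -> r a = r b,
      r 1 = 1 &
      forall Q : P -> Prop, Q 1 ->
        (forall a s, r (r a * gen s) = r a * gen s ->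
           Q (r a) <-> Q (r a * gen s)) ->
        forall a, Q (r a)].
Proof.
pose r a := schreier (height a) a.
have rep a : r a ~ a by apply/schreier_rep/heightP.
have inv a b : a ~ b -> r a = r b.
  by move=> ab; rewrite /r (height_coset ab) (schreier_coset _ ab).
exists r; split=> //.
  suff h1 : height 1 = 0 by rewrite /r h1.
  apply/eqP; rewrite -leqn0; apply: height_min.
  by exists [::]; last exact: coset_refl.
move=> Q Q1 Qs a; have [n] := ubnP (height a); elim: n a => // n IH a.
rewrite ltnS => an; have [ra1|[b [[s c] [ba raE]]]] := schreier_stem a.
  by rewrite /r ra1.
have Qb : Q (r b) by apply: IH; apply: leq_trans ba an.
have rr x : r (r x) = r x by apply: inv.
rewrite -/(r a) -/(r b) pi_letter in raE.
case: c raE => raE.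
  have raE' : r a * gen s = r b by rewrite raE mulgVK.
  by apply/(Qs a s); rewrite raE' ?rr.
by rewrite raE; apply/(Qs b s); rewrite -?raE ?rr.
Qed.

End Schreier.

Lemma free_hom_eq (X : choiceType) (K : groupType) (f g : free_group X -> K) :
  {morph f : x y / x * y} -> {morph g : x y / x * y} ->
  (forall x, f (presented_gen _ x) = g (presented_gen _ x)) -> f =1 g.
Proof.
move=> fM gM fg; apply: presented_ind => [|a s].
  have morph1 (h : free_group X -> K) : {morph h : x y / x * y} -> h 1 = 1.
    by move=> hM; apply: (mulgI (h 1)); rewrite -hM !mulg1.
  by rewrite !morph1.
by rewrite fM gM fg; split=> [-> //|/mulIg].
Qed.

(** The generators are indexed by the edges [(a, s)] of the quotient of the
    Cayley graph by [G] outside the Schreier tree, [a] being the representative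
    of its coset; [theta] sends such an edge to the loop in [G] that it closes.
    Labelling each of these edges by its generator and the tree by [1] gives a
    potential [Phi]. The labels become the loops themselves under [theta], so
    [theta \o Phi] is the identity on [G]; and [Phi] is trivial on the
    transversal, so [Phi] sends each loop back to its generator. *)
Theorem subgroup_free (X : choiceType) (G : set (free_group X)) :
  subgroup G -> is_free G.
Proof.
move=> Gs; set A := free_group X in G Gs *.
have [r [rep inv r1 rind]] := schreier_transversal Gs.
pose gn : X -> A := presented_gen _.
pose nontree (p : A * X) :=
  (r p.1 == p.1) && (r (p.1 * gn p.2) != p.1 * gn p.2).
pose Y : choiceType := {p | nontree p}.
have [theta thetaE] := @free_hom Y A (fun y =>
  (val y).1 * gn (val y).2 / r ((val y).1 * gn (val y).2)).
pose C s (a : A) : free_group Y :=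
  if insub (r a, s) is Some y then presented_gen _ y else 1.
have [Phi [Phi1 PhiS]] : exists Phi : A -> free_group Y, Phi 1 = 1 /\
    forall s a, Phi (a * gn s) = Phi a * C s a.
  exact: presented_potential.
have rr a : r (r a) = r a by apply: inv.
have rs a s : r (r a * gn s) = r (a * gn s).
  by apply: inv; apply: coset_mulr; apply: rep.
have thetaC s a : theta (C s a) = r a * gn s / r (a * gn s).
  rewrite /C; case: insubP => [y _ yE|].
    by rewrite thetaE yE /= rs.
  by rewrite /nontree /= rr eqxx rs negbK => /eqP->; rewrite divgg gmulf1.
have thetaPhi : forall a, theta (Phi a) = a / r a.
  apply: presented_ind => [|a s].
    by rewrite Phi1 gmulf1 r1 divgg.
  rewrite PhiS gmulfM thetaC -mulgA; split=> [->|].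
    by rewrite !mulgA mulgVK.
  rewrite !mulgA => /mulIg/mulIg h.
  by apply: (mulIg (r a)); rewrite h mulgVK.
have PhiM g a : G g -> Phi (g * a) = Phi g * Phi a.
  move=> Gg; apply: (potential_left Phi1 PhiS) => s b.
  by rewrite /C (inv _ b) //; apply: coset_mull.
have thetaG x : G (theta x).
  move: x; apply: presented_ind => [|x y].
    by rewrite gmulf1; exact: Gs.1.
  rewrite gmulfM thetaE; set t := (_ / _).
  have Gt : G t by apply: coset_sym (rep _).
  split=> Gx; first exact: subgM.
  by rewrite -(mulgK t (theta x)); apply: Gs.2.
have Phir a : Phi (r a) = 1.
  apply: (rind (fun x => Phi x = 1)) => // {}a s rE.
  rewrite PhiS /C rr; case: insubP => [y|_]; last by rewrite mulg1.
  by rewrite /nontree rE eqxx andbF.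
have PhiTheta : cancel theta Phi.
  apply: (@free_hom_eq _ _ (Phi \o theta) id) => [x y||y] //=.
    by rewrite gmulfM PhiM; last exact: thetaG.
  case: y (thetaE y) => -[a s] /= /[dup] /andP[/= /eqP ra nt] py ->.
  have Gt : G (a * gn s / r (a * gn s)) by apply: coset_sym (rep _).
  rewrite -[LHS]mulg1 -(Phir (a * gn s)) -PhiM // mulgVK.
  have Phia : Phi a = 1 by rewrite -ra Phir.
  rewrite PhiS Phia mul1g /C ra.
  case: insubP => [y _ yE|]; last by rewrite py.
  by congr presented_gen; apply: val_inj.
exists Y, theta; split; first exact: can_inj PhiTheta.
apply/seteqP; split=> [_ [x _ <-]|g Gg]; first exact: thetaG.
exists (Phi g) => //; rewrite thetaPhi (inv _ 1) ?r1 ?divg1 //.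
by rewrite /coset_eq divg1.
Qed.

(** * Retracts of free groups *)

(** The maps [psi] and [theta] are only related on [G]: away from [G], [psi] is
    arbitrary, and [theta] takes its values in [A]. *)
Definition free_retract (A : groupType) (G : set A) : Prop :=
  exists (X : choiceType) (psi : A -> free_group X)
         (theta : UMagmaMorphism.type (free_group X) A),
    (forall x y, G x -> G y -> psi (x * y) = psi x * psi y) /\
    (forall x, G x -> theta (psi x) = x).

(** [psi] identifies [G] with a subgroup of a free group. *)
Lemma free_retract_is_free (A : groupType) (G : set A) :
  subgroup G -> free_retract G -> is_free G.
Proof.
move=> Gs [X [psi [theta [psiM psiK]]]].
have psi1 : psi 1 = 1.
  by apply: (mulgI (psi 1)); rewrite -psiM ?mulg1 //; exact: Gs.1.
have psiF x y : G x -> G y -> psi (x / y) = psi x / psi y.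
  move=> Gx Gy; apply: (mulIg (psi y)); rewrite mulgVK -psiM ?mulgVK //.
  exact: Gs.2.
have [|Y [phi [phiI phiE]]] := @subgroup_free X (psi @` G).
  split; first by exists 1; [exact: Gs.1|].
  move=> _ _ [x Gx <-] [y Gy <-]; exists (x / y); last exact: psiF.
  exact: Gs.2.
have phiG y : exists2 x, G x & psi x = phi y.
  by have : range phi (phi y) by []; rewrite phiE.
exists Y, (theta \o phi); split.
  move=> y z /= yz; apply: phiI.
  have [[a Ga ay] [b Gb bz]] := (phiG y, phiG z).
  by rewrite -ay -bz; congr psi; rewrite -(psiK a) // -(psiK b) // ay bz.
apply/seteqP; split=> [_ [y _ <-]|x Gx] /=.
  by have [x Gx <-] := phiG y; rewrite psiK.
have : (psi @` G) (psi x) by exists x.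
by rewrite -phiE => -[y _ yE]; exists y => //=; rewrite yE psiK.
Qed.

Lemma dep_choice (I : Type) (T : I -> Type) (Q : forall i, T i -> Prop) :
  (forall i, exists x, Q i x) -> exists f : forall i, T i, forall i, Q i (f i).
Proof. by move=> h; exists (fun i => projT1 (cid (h i))) => i; case: cid. Qed.

(** A free product of the free groups that belong to the [G i], with additional
    generators whose images under [theta] are prescribed by [k]. *)
Lemma free_retract_family (I : choiceType) (A B : groupType) (G : I -> set B)
    (f : I -> B -> A) (k : I -> A) :
  (forall i, {morph f i : x y / x * y}) ->
  (forall i, free_retract (G i)) ->
  exists (X : choiceType) (theta : UMagmaMorphism.type (free_group X) A)
         (J : I -> B -> free_group X) (x : I -> free_group X),
    [/\ forall i b c, G i b -> G i c -> J i (b * c) = J i b * J i c,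
        forall i b, G i b -> theta (J i b) = f i b &
        forall i, theta (x i) = k i].
Proof.
rewrite /free_retract => fM.
move=> /choice[X0 /dep_choice[psi0 /dep_choice[theta0 h]]].
pose X : choiceType := ({i : I & X0 i} + I)%type.
have [theta thetaE] := @free_hom X A (fun x => match x with
  | inl p => f (tag p) (theta0 (tag p) (presented_gen _ (tagged p)))
  | inr i => k i end).
have /dep_choice[j jE] i :
    exists j : UMagmaMorphism.type (free_group (X0 i)) (free_group X),
    forall x, j (presented_gen _ x) = presented_gen _ (inl (Tagged X0 x) : X).
  exact: free_hom.
exists X, theta, (fun i b => j i (psi0 i b)),
  (fun i => presented_gen _ (inr i : X)).
split=> [i b c Gb Gc|i b Gb|i]; last by rewrite thetaE.
  by rewrite (h i).1 // gmulfM.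
rewrite -[in RHS](((h i).2) b Gb); move: (psi0 i b) => {b Gb}.
apply: (@free_hom_eq _ _ (theta \o j i) (f i \o theta0 i)) => [x y|x y|x] /=.
- by rewrite !gmulfM.
- by rewrite gmulfM fM.
- by rewrite jE thetaE.
Qed.

(** * Representatives of double cosets *)

Section DoubleCosets.
Variables (A B : groupType) (iota : UMagmaMorphism.type B A).
Variables (G : set A) (Q : set B).
Hypotheses (Gs : subgroup G) (Qs : subgroup Q).
Local Notation "x ~ y" := (coset_eq G x y) (at level 70).

(** The double coset of [a] with respect to [G] and the image of [Q]. The
    element [a] lies in the coset of [drep a * iota (dcoord a)]. *)
Definition dcoset a : set A := [set d | exists2 h, Q h & a * iota h ~ d].
Definition drep a := xget 1 (dcoset a).
Definition dcoord a := xget 1 [set h | Q h /\ a / iota h ~ drep a].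

Lemma dcoordP a : Q (dcoord a) /\ a / iota (dcoord a) ~ drep a.
Proof.
have [h Qh ha] : dcoset a (drep a).
  apply: (@xgetPex _ _ _ _); exists a, 1; first exact: Qs.1.
  by rewrite gmulf1 mulg1; apply: coset_refl.
suff /(xgetPex 1) : exists c, [set c | Q c /\ a / iota c ~ drep a] c by [].
by exists h^-1; rewrite /= gmulfV invgK; split=> //; apply: subgV.
Qed.

Lemma drep_coset a b : a ~ b -> drep a = drep b.
Proof.
move=> ab; congr xget; apply/predeqP => d; split=> -[h Qh hd]; exists h => //.
  by apply: coset_trans hd => //; apply: coset_mulr; apply: coset_sym.
by apply: coset_trans hd => //; apply: coset_mulr.
Qed.

Lemma dcoord_coset a b : a ~ b -> dcoord a = dcoord b.
Proof.
move=> ab; rewrite /dcoord (drep_coset ab); congr xget.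
apply/predeqP => h; split=> -[Qh hd]; split=> //.
  by apply: coset_trans hd => //; apply: coset_mulr; apply: coset_sym.
by apply: coset_trans hd => //; apply: coset_mulr.
Qed.

Lemma drep_mulr a t : Q t -> drep (a * iota t) = drep a.
Proof.
move=> Qt; congr xget; apply/predeqP => d; split=> -[h Qh].
  by rewrite -mulgA -gmulfM => hd; exists (t * h) => //; apply: subgM.
move=> hd; exists (t^-1 * h); first by apply: subgM => //; apply: subgV.
by rewrite -mulgA -gmulfM mulVKg.
Qed.

(** The assumption says that [Q] acts freely on the coset of [a], so the
    coordinate of an element of the orbit is unique. *)
Lemma dcoord_mulr a t : Q t ->
  (forall h, Q h -> G (iota h ^ a^-1) -> h = 1) ->
  dcoord (a * iota t) = dcoord a * t.
Proof.
move=> Qt stab1; have [[Qa da] [Qat dat]] := (dcoordP a, dcoordP (a * iota t)).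
set h := dcoord a in Qa da *; set h' := dcoord _ in Qat dat *.
rewrite drep_mulr // in dat.
have : t / h' * h = 1.
  apply: stab1; first by apply: subgM => //; apply: Qs.2.
  have := coset_trans Gs dat (coset_sym Gs da).
  by rewrite /coset_eq conjgE !gmulfM gmulfV !invgM !invgK !mulgA.
by move=> /mulg1_eq; rewrite invgF => <-; rewrite mulgVK.
Qed.

End DoubleCosets.

(** * Induction on the number of vertices *)

(** The elements that commute with a vertex include the subgroup generated by
    its link, so this condition makes [G] act freely on the edges of the
    Bass-Serre trees. Stated with centralizers, it passes to the vertex
    groups. *)
Definition centralizer_free (V : finType) (e : rel V) (G : set (raag e)) :=
  forall g a s, G g -> commute g (raag_gen e s ^ a) -> g = 1.

Section Step.
Variables (V : finType) (e : rel V) (v : V).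
Hypotheses (e_sym : symmetric e) (e_irr : irreflexive e).
Local Notation A := (raag e).
Local Notation B := (raag (del_rel e v)).
Local Notation gen := (raag_gen e).
Variable iota : UMagmaMorphism.type B A.
Hypothesis iotaI : injective iota.
Hypothesis iotaE : forall w, iota (raag_gen _ w) = gen (val w).
Variable G : set A.
Hypotheses (Gs : subgroup G) (Gc : centralizer_free G).
Local Notation "x ~ y" := (coset_eq G x y) (at level 70).

(** In the notation of the proof, [r] is a transversal of the cosets of [G],
    built from representatives of the double cosets of [G] and [B]. The
    labelling [C] is chosen such that its image under [theta] is the labelling
    by the elements [r a * gen s / r (a * gen s)] of [G], which has the evident
    potential [r 1 * a / r a]; so [theta] undoes the potential of [C] on [G], up
    to conjugation by [r 1]. *)
Lemma free_retract_step :
  (forall d, free_retract [set b | G (iota b ^ d^-1)]) -> free_retract G.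
Proof.
move=> stabP.
have sm := @coset_sym _ _ Gs; have tr := @coset_trans _ _ Gs.
have mr := @coset_mulr _ G.
pose H := [set h : B | commute (iota h) (gen v)].
have Ts : subgroup [set: B] by [].
have Hs : subgroup H.
  split=> [|x y Hx Hy]; rewrite /H /= ?gmulf1 ?gmulfF; apply: commute_sym.
    exact: commute1.
  by apply: commuteM; [|apply: commuteV]; apply: commute_sym.
pose D := drep iota G [set: B]; pose beta := dcoord iota G [set: B].
pose u := drep iota G H; pose eta := dcoord iota G H.
pose r a := D a * iota (beta a).
have rE a : r a ~ a.
  have [_ /(mr (iota (beta a)))] := dcoordP iota Gs Ts a.
  by rewrite mulgVK => /sm.
have r_coset a b : a ~ b -> r a = r b.
  move=> ab; rewrite /r /D /beta (drep_coset _ _ Gs ab).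
  by rewrite (dcoord_coset _ _ Gs ab).
have uE a : u a * iota (eta a) ~ a.
  have [_ /(mr (iota (eta a)))] := dcoordP iota Gs Hs a.
  by rewrite mulgVK => /sm.
have etaM a t : H t -> eta (a * iota t) = eta a * t.
  move=> Ht; apply: (dcoord_mulr Gs Hs) => // h Hh Gh.
  apply: iotaI; rewrite gmulf1; apply: (@conjg_inj _ a^-1); rewrite conj1g.
  by apply: (Gc (a := a^-1) (s := v) Gh); rewrite /commute -!conjMg Hh.
have iotaJ (d : A) : {morph (fun b => iota b ^ d^-1) : b c / b * c}.
  by move=> b c; rewrite gmulfM conjMg.
have [X [theta [J [x [JM thetaJ thetax]]]]] :=
  free_retract_family (fun d => r d * gen v / r (d * gen v)) iotaJ stabP.
(* The label of a path that starts at [a] and follows [b]: the stabilizer in [B]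
   of the coset of [D a] contains the element between the two coordinates. *)
pose Cb b a := J (D a) (beta a * b / beta (a * iota b)).
have D_mulr a b : D (a * iota b) = D a by apply: drep_mulr.
have stabE a b : iota (beta a * b / beta (a * iota b)) ^ (D a)^-1 =
    r a * iota b / r (a * iota b).
  by rewrite /r D_mulr conjgE invgK gmulfF !gmulfM invgM !mulgA.
(* From now on [r] is used through its properties only; its definition as a
   product would be exposed by the normalization of products below. *)
clearbody r.
have stabG a b : G (iota (beta a * b / beta (a * iota b)) ^ (D a)^-1).
  by rewrite stabE; apply: tr (sm _ _ (rE _)); apply: mr.
have CbM b c a : Cb (b * c) a = Cb b a * Cb c (a * iota b).
  rewrite /Cb D_mulr -JM /=; [|exact: stabG|].
    by rewrite gmulfM !mulgA mulgVK.
  by have := stabG (a * iota b) c; rewrite D_mulr.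
have Cb_coset b a a' : a ~ a' -> Cb b a = Cb b a'.
  move=> aa; rewrite /Cb /D /beta (drep_coset _ _ Gs aa).
  rewrite (dcoord_coset _ _ Gs aa).
  by rewrite (dcoord_coset _ _ Gs (mr (iota b) _ _ aa)).
have thetaCb b a : theta (Cb b a) = r a * iota b / r (a * iota b).
  by rewrite thetaJ; [exact: stabE|exact: stabG].
(* In the [H]-orbit of edges labelled [v], the one at [u a] gets the free
   generator [x (u a)]; the label at [a] closes the strip of squares between
   these two edges, whose long sides follow [eta a]. *)
pose Cv a := (Cb (eta a) (u a))^-1 * x (u a) * Cb (eta a) (u a * gen v).
have H_comm h a : H h -> a * gen v * iota h = a * iota h * gen v.
  by move=> Hh; rewrite -!mulgA Hh.
have etaH a : H (eta a) by have [] := dcoordP iota Gs Hs a.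
have uvE a : u a * gen v * iota (eta a) ~ a * gen v.
  by rewrite H_comm; [apply: mr; exact: uE|exact: etaH].
(* The strip that follows [t] from [a] prolongs the strip of [a] to the strip of
   [a * iota t]. *)
have CvM t a : H t -> Cb t a * Cv (a * iota t) = Cv a * Cb t (a * gen v).
  move=> Ht; rewrite /Cv etaM // [u (_ * _)](drep_mulr _ _ Hs) // -/(u a).
  rewrite !CbM (Cb_coset _ _ _ (uE a)) (Cb_coset _ _ _ (uvE a)).
  by rewrite invgM !mulgA mulgV mul1g.
have Cv_coset a b : a ~ b -> Cv a = Cv b.
  move=> ab; rewrite /Cv /u /eta (drep_coset _ _ Gs ab).
  by rewrite (dcoord_coset _ _ Gs ab).
have thetaCv a : theta (Cv a) = r a * gen v / r (a * gen v).
  rewrite /Cv !gmulfM gmulfV !thetaCb thetax.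
  rewrite (r_coset _ _ (uE a)) (r_coset _ _ (uvE a)).
  rewrite invgM invgK invgM !mulgA !mulgVK.
  by rewrite H_comm ?mulgVK.
pose C s a :=
  if insub s is Some w then Cb (raag_gen (del_rel e v) w) a else Cv a.
have H_gen (w : {s | s != v}) : e (val w) v -> H (raag_gen (del_rel e v) w).
  by move=> wv; rewrite /H /= iotaE; exact: raag_gen_commute.
have [Phi [Phi1 PhiS]] : exists Phi : A -> free_group X, Phi 1 = 1 /\
    forall s a, Phi (a * gen s) = Phi a * C s a.
  apply/presented_potential/raag_potential => s t a; rewrite /C.
  case: insubP => [w _ <-|]; case: insubP => [w' _ <-|].
  - move=> ww'; rewrite -!iotaE -!CbM; congr Cb.
    exact: (@raag_gen_commute _ (del_rel e v)).
  - by move=> /negPn/eqP-> /H_gen Hw; rewrite -iotaE CvM.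
  - by move=> /negPn/eqP->; rewrite e_sym => /H_gen Hw; rewrite -iotaE CvM.
  - by move=> /negPn/eqP-> /negPn/eqP->; rewrite e_irr.
have thetaC s a : theta (C s a) = r a * gen s / r (a * gen s).
  rewrite /C; case: insubP => [w _ <-|/negPn/eqP->//]; by rewrite thetaCb iotaE.
have C_coset s a b : a ~ b -> C s a = C s b.
  move=> ab; rewrite /C (Cv_coset _ _ ab).
  by case: insub => // w; apply: Cb_coset.
have thetaPhi : forall a, theta (Phi a) = r 1 * a / r a.
  apply: presented_ind => [|a s].
    by rewrite Phi1 gmulf1 mulg1 divgg.
  rewrite PhiS gmulfM thetaC; split=> [->|]; first by rewrite !mulgA mulgVK.
  by rewrite !mulgA => /mulIg/mulIg h; apply: (mulIg (r a)); rewrite h mulgVK.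
(* Conjugation by [r 1], since [r] need not send [1] to [1]. *)
have [theta' theta'E] :=
  free_hom (fun y : X => theta (presented_gen _ y) ^ r 1).
have {theta'E}theta'E : theta' =1 (fun z => theta z ^ r 1).
  by apply: free_hom_eq => // y z; rewrite gmulfM ?conjMg.
exists X, Phi, theta'; split=> [g h Gg _|g Gg].
  apply: (potential_left Phi1 PhiS) => s b; apply: C_coset; exact: coset_mull.
rewrite theta'E thetaPhi (r_coset g 1); last by rewrite /coset_eq divg1.
by rewrite conjgE !mulgA mulVg mul1g mulgVK.
Qed.

End Step.

(** The subgroups of the Artin group [B] of the smaller graph to which the
    induction applies are the intersections of [B] with the conjugates of [G].
    A vertex of the smaller graph is a vertex of the whole graph, so these
    inherit the condition on centralizers. *)
Lemma free_retract_raag n (V : finType) (e : rel V) (G : set (raag e)) :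
  #|V| = n -> symmetric e -> irreflexive e -> subgroup G ->
  centralizer_free G -> free_retract G.
Proof.
elim: n V e G => [|n IH] V e G cardV e_sym e_irr Gs Gc.
  have V0 (s : V) : False by have := max_card (pred1 s); rewrite card1 cardV.
  have [theta _] := @free_hom V (raag e) (fun=> 1).
  exists V, (fun=> 1), theta; split=> [x y _ _|x _]; first by rewrite mulg1.
  rewrite gmulf1; move: x; apply: presented_ind => // a s; by case: (V0 s).
have [v _] : exists v : V, v \in V by apply/card_gt0P; rewrite cardV.
have [iota [iotaI iotaE]] := raag_sub e v.
apply: (free_retract_step e_sym e_irr iotaI iotaE Gs Gc) => d.
apply: IH.
- by rewrite card_sig; have := cardC1 v; rewrite cardV.
- by move=> s t; apply: e_sym.
- by move=> s; apply: e_irr.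
- split=> [|b c] /=; first by rewrite gmulf1 conj1g; exact: Gs.1.
  by rewrite gmulfF conjMg conjVg; apply: Gs.2.
move=> b a s Gb bs; apply: iotaI; rewrite gmulf1.
apply: (@conjg_inj _ d^-1); rewrite conj1g.
apply: (Gc _ (iota a / d) (val s) Gb).
rewrite -iotaE conjgM -gmulfJ /commute -!conjMg; congr (_ ^ _).
exact: gmulf_commute.
Qed.

(** * Purely loxodromic subgroups *)

(** An element that commutes with [raag_gen e s ^ a] fixes this vertex of the
    extension graph, so the displacement of that vertex under all of its powers
    is zero. *)
Lemma purely_loxodromic_centralizer_free (R : realType) (V : finType)
    (e : rel V) (G : set (raag e)) :
  purely_loxodromic R G -> centralizer_free G.
Proof.
move=> Glox g a s Gg gc; apply: contrapT => g1.
have xP : is_ext_vertex (raag_gen e s ^ a) by apply/asboolP; exists s, a.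
have [l l0] := Glox g Gg g1 (Sub _ xP).
have fixg n : ext_act (Sub _ xP : ext_vertex e) (g ^+ n) = Sub _ xP.
  apply: val_inj => /=; apply/conjg_fixP/commgP/commuteX; exact: commute_sym.
have dist0 x : graph_dist (@ext_adj V e) x x = 0.
  rewrite /graph_dist; case: pselect => // ex; case: ex_minnP => m _ min.
  by apply/eqP; rewrite -leqn0; apply: min; apply/asboolP; exists [::].
under eq_fun do rewrite fixg dist0 GRing.mulr0.
by move=> /cvg_lim l_lim; move: l0; rewrite -l_lim ?lim_cst ?ltxx.
Qed.

Theorem theorem53 (R : realType) (V : finType) (e : rel V)
    (e_sym : symmetric e) (e_irr : irreflexive e)
    (e_conn : forall x y, connect e x y)
    (G : set (raag e)) (G_sub : group_closed (mem G))
    (G_lox : purely_loxodromic R G) :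
  is_free G.
Proof.
have Gs : subgroup G.
  case: G_sub => /set_mem G1 GF; split=> // x y Gx Gy.
  by apply/set_mem/GF; apply/mem_set.
apply: free_retract_is_free => //.
apply: free_retract_raag => //.
exact: purely_loxodromic_centralizer_free G_lox.
Qed.
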